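(* Let $(\mathcal{X},\mathcal{B}(\mathcal{X}))$ be a Polish space, let $\mu,\nu$ be probability measures on it with $\mathcal{D}_\varphi(\mu\|\nu)<\infty$, where $\varphi\in\mathcal{C}^2(\mathbb{R}^+)$ is strictly convex and satisfies the normality conditions $\varphi(1)=0$, $\varphi'(1)=0$, $\inf_{x>0}\varphi(x)>-\infty$. Then for every $f\in L_{\varphi^*}(\mathcal{X},\nu)$ there exist $\mathfrak{B}_{\varphi,+}(\mu\|\nu;f),\ \mathfrak{B}_{\varphi,-}(\mu\|\nu;f)\in\mathbb{R}$ such that $$\mathfrak{B}_{\varphi,-}(\mu\|\nu;f)\;\leqslant\;\mathbb{E}^{\mu}[f]-\mathbb{E}^{\nu}[f]\;\leqslant\;\mathfrak{B}_{\varphi,+}(\mu\|\nu;f),$$ where $$\mathfrak{B}_{\varphi,\pm}(\mu\|\nu;f):=\pm\inf_{\lambda>0}\Big\{\frac1\lambda\int_{\mathcal{X}}\varphi^*\big(\pm\lambda(f-\mathbb{E}^\nu[f])\big)\,d\nu+\frac1\lambda\mathcal{D}_\varphi(\mu\|\nu)\Big\},$$ and $\mathfrak{B}_{\varphi,+}(\mu\|\nu;f)=\mathfrak{B}_{\varphi,-}(\mu\|\nu;f)=0$ if and only if $\mu=\nu$ or $f$ is constant $\nu$-a.s.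
   Context: $\mathbb{E}^\mu[f]=\int f\,d\mu$. The function $\varphi:[0,\infty)\to(-\infty,\infty)$ is strictly convex; $\varphi\in\mathcal{C}^2(\mathbb{R}^+)$ means twice continuously differentiable on $(0,\infty)$. The $\varphi$-divergence is $\mathcal{D}_\varphi(\mu\|\nu)=\int_{\mathcal X}\varphi\big(\frac{d\mu}{d\nu}\big)d\nu$ if $\mu\ll\nu$ and $\varphi\big(\frac{d\mu}{d\nu}\big)\in L^1(\mathcal{X},\nu)$, and $+\infty$ otherwise. The convex conjugate is $\varphi^*(\xi)=\sup_{u\geqslant0}\{u\xi-\varphi(u)\}$, $\xi\in\mathbb{R}$. The Orlicz subspace is $$L_{\varphi^*}(\mathcal{X},\nu)=\Big\{f:\mathcal X\to\mathbb{R}\text{ Borel measurable}:\ \forall\gamma>0,\ \int_{\mathcal{X}}\varphi^*(\gamma f)\,d\nu+\int_{\mathcal{X}}\varphi^*(-\gamma f)\,d\nu<\infty\Big\}.$$ *)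

(* Defs.v *)
From HB Require Import structures.
From mathcomp Require Import all_boot all_order all_algebra.
From mathcomp Require Import all_classical all_reals all_analysis.

Set Implicit Arguments.
Unset Strict Implicit.
Unset Printing Implicit Defensive.

Import Order.TTheory GRing.Theory Num.Theory.
Import numFieldNormedType.Exports.

Local Open Scope ring_scope.
Local Open Scope classical_set_scope.

Definition is_metric (R : realType) (T : Type) (d : T -> T -> R) : Prop :=
  [/\ forall x y, d x y = 0 <-> x = y,
      forall x y, d x y = d y x &
      forall x y z, d x z <= d x y + d y z].

Definition metrizes (R : realType) (T : topologicalType) (d : T -> T -> R) :
    Prop :=
  forall (x : T) (A : set T),
    nbhs x A <-> exists2 e : R, 0 < e & [set y | d x y < e] `<=` A.

Definition cauchy_seq (R : realType) (T : Type) (d : T -> T -> R)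
    (u : nat -> T) : Prop :=
  forall e : R, 0 < e ->
    exists N : nat, forall m n : nat, (N <= m)%N -> (N <= n)%N ->
      d (u m) (u n) < e.

Definition polish (R : realType) (T : topologicalType) : Prop :=
  (exists2 D : set T, countable D & dense D) /\
  (exists d : T -> T -> R,
    [/\ is_metric d, metrizes d &
        forall u : nat -> T, cauchy_seq d u ->
          exists l : T, u @ \oo --> l]).

Notation borel T := (g_sigma_algebraType (@open T)).

(* A function [0, +oo[ -> R is represented by a total phi : R -> R; nothing
   below depends on the values of phi at negative arguments. *)
Definition strictly_convex_nonneg (R : realType) (phi : R -> R) : Prop :=
  forall x y t : R, 0 <= x -> 0 <= y -> x != y -> 0 < t -> t < 1 ->
    phi (t * x + (1 - t) * y) < t * phi x + (1 - t) * phi y.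

Definition C2_pos (R : realType) (phi : R -> R) : Prop :=
  forall x : R, 0 < x ->
    [/\ derivable phi x 1, derivable (phi^`()) x 1 &
        {for x, continuous (phi^`(2))}].

Definition convex_conjugate (R : realType) (phi : R -> R) (xi : R) : \bar R :=
  ereal_sup [set (u * xi - phi u)%:E | u in [set u : R | 0 <= u]].

Section divergence.
Context (d : measure_display) (X : measurableType d) (R : realType).
Implicit Types (mu nu : probability X R) (phi f : R -> R).

(* Radon_Nikodym_SigmaFinite.f mu nu is an everywhere nonnegative version of
   d mu / d nu. The charge-based 'd mu '/d nu is nonnegative only nu-a.e., and
   phi is meaningless (possibly not even measurable) on negative arguments. *)
Definition divergence phi mu nu : \bar R :=
  let h x := (phi (fine (Radon_Nikodym_SigmaFinite.f mu nu x)))%:E in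
  if `[< mu `<< nu /\ nu.-integrable [set: X] h >]
  then (\int[nu]_x h x)%E else +oo%E.

Definition orlicz phi nu : set (X -> R) :=
  [set f | measurable_fun [set: X] f /\
    forall gamma : R, 0 < gamma ->
      (\int[nu]_x convex_conjugate phi (gamma * f x)%R
       + \int[nu]_x convex_conjugate phi (- gamma * f x)%R < +oo)%E].

Definition bound_plus phi mu nu (f : X -> R) : \bar R :=
  (ereal_inf [set
    (lambda^-1)%R%:E * (\int[nu]_x convex_conjugate phi
                          (lambda * (f x - fine 'E_nu[f]))%R)
     + (lambda^-1)%R%:E * divergence phi mu nu
    | lambda in [set lambda : R | (0 < lambda)%R]])%E.

Definition bound_minus phi mu nu (f : X -> R) : \bar R :=
  (- ereal_inf [set
    (lambda^-1)%R%:E * (\int[nu]_x convex_conjugate phi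
                          (- lambda * (f x - fine 'E_nu[f]))%R)
     + (lambda^-1)%R%:E * divergence phi mu nu
    | lambda in [set lambda : R | (0 < lambda)%R]])%E.

End divergence.

(* Main.v *)
Require Import Defs.
From HB Require Import structures.
From mathcomp Require Import all_boot all_order all_algebra.
From mathcomp Require Import all_classical all_reals all_analysis.
From mathcomp Require Import measurable_realfun lra.

Set Implicit Arguments.
Unset Strict Implicit.
Unset Printing Implicit Defensive.

Import Order.TTheory GRing.Theory Num.Theory.
Import numFieldNormedType.Exports.

Local Open Scope ring_scope.
Local Open Scope classical_set_scope.

(** Write psi for the conjugate of phi, D for the divergence,
    p for the density of mu with respect to nu, and g = f - E^nu[f]. The
    inequality is convex duality: integrating Young's inequality
    l g p <= psi (l g) + phi p against nu gives
    l E^mu[g] <= \int psi (l g) dnu + D for every real l ([gibbs_variational]),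
    and dividing by l > 0 bounds E^mu[g] = E^mu[f] - E^nu[f] from above. Applied
    to - g, the same estimate is the lower bound. The bounds are finite because
    psi (l g) is nu-integrable for every l
    ([conjugate_centered_integrable]): either psi is finite everywhere, and then
    monotonicity of psi absorbs the constant E^nu[f], or psi is infinite
    somewhere, and then f vanishes nu-almost everywhere.

    The equality case rests on the behaviour of psi at 0. Since phi is
    nonnegative and vanishes exactly at 1, where it has zero slope,
    - psi xi > xi for xi <> 0, because phi is o(h) at 1 + h
      ([conjugate_gt_id]);
    - psi xi <= xi + e |xi| near 0, because phi > 0 away from 1
      ([conjugate_le_near0]).
    Since E^nu[g] = 0, the first point makes \int psi g dnu positive unless
    g = 0 almost everywhere. The bound is an infimum over l of
    l^-1 \int psi (l g) dnu + l^-1 D; for l < 1 the second term is at least D,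
    for l >= 1 the first one is at least \int psi g dnu, so the infimum is
    positive as soon as D > 0 and g is not almost everywhere 0
    ([conjugate_bound_gt0]). Conversely, if g = 0 almost everywhere, only
    l^-1 D remains and tends to 0 as l grows; if D = 0, that is mu = nu, the
    second point and dominated convergence give
    l^-1 \int psi (l g) dnu --> E^nu[g] = 0 as l tends to 0. *)

(** * Integrals bounded below *)

Section integral_lbounded.
Context d (T : measurableType d) (R : realType).
Variable nu : {finite_measure set T -> \bar R}.
Local Open Scope ereal_scope.

(** The negative part is bounded, so only the positive part decides whether the
    integral is finite. *)
Lemma integral_lbounded (h : T -> \bar R) (c : R) :
  measurable_fun [set: T] h -> (forall x, c%:E <= h x) ->
  -oo < \int[nu]_x h x /\
  (\int[nu]_x h x < +oo -> nu.-integrable [set: T] h).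
Proof.
move=> mh ch.
have Nfin : \int[nu]_x h^\- x \is a fin_num.
  rewrite ge0_fin_numE; last exact: integral_ge0.
  apply: (@le_lt_trans _ _ (\int[nu]_x cst `|c|%:E x)).
    apply: ge0_le_integral => //; first exact: measurable_funeneg.
    move=> x _; rewrite funenegE ge_max; apply/andP; split; last by rewrite lee_fin.
    by rewrite leeNl -EFinN (le_trans _ (ch x))// lee_fin lerNl -normrN ler_norm.
  exact: integrable_lty (finite_measure_integrable_cst nu `|c| measurableT).
have P0 : 0 <= \int[nu]_x h^\+ x by exact: integral_ge0.
rewrite integralE; split.
  rewrite -(fineK Nfin).
  by case: (\int[nu]_x h^\+ x) P0 => // r _; rewrite ltNyr.
move=> Pfin; apply/integrableP; split => //.
have -> : \int[nu]_x `|h x| = \int[nu]_x (h^\+ x + h^\- x).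
  by apply: eq_integral => x _; have := congr1 (@^~ x) (fune_abse h).
rewrite ge0_integralD//; [|exact: measurable_funepos|exact: measurable_funeneg].
move: Pfin P0; rewrite -(fineK Nfin).
by case: (\int[nu]_x h^\+ x) => // r _ _; rewrite -EFinD ltry.
Qed.

End integral_lbounded.

(** * Change of measure by a density *)

Section change_of_measure.
Context d (T : measurableType d) (R : realType).
Variables (mu : {finite_measure set T -> \bar R})
          (nu : {sigma_finite_measure set T -> \bar R}).
Hypothesis mu_nu : mu `<< nu.
Local Open Scope ereal_scope.

Let p x := fine (Radon_Nikodym_SigmaFinite.f mu nu x).

Lemma density_ge0 x : (0 <= p x)%R.
Proof. exact/fine_ge0/Radon_Nikodym_SigmaFinite.f_ge0. Qed.

Lemma EFin_density x : (p x)%:E = Radon_Nikodym_SigmaFinite.f mu nu x.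
Proof. by rewrite fineK// Radon_Nikodym_SigmaFinite.f_fin_num. Qed.

Lemma integrable_density : nu.-integrable [set: T] (EFin \o p).
Proof.
rewrite (_ : EFin \o p = Radon_Nikodym_SigmaFinite.f mu nu).
  exact: Radon_Nikodym_SigmaFinite.f_integrable.
by apply/funext => x; exact: EFin_density.
Qed.

Lemma measurable_density : measurable_fun [set: T] p.
Proof. by apply/measurable_EFinP; exact: measurable_int integrable_density. Qed.

Lemma ge0_integral_density (h : T -> \bar R) : (forall x, 0 <= h x) ->
  measurable_fun [set: T] h -> \int[nu]_x (h x * (p x)%:E) = \int[mu]_x h x.
Proof.
move=> h0 mh; rewrite -(Radon_Nikodym_SigmaFinite.change_of_variables mu_nu)//.
by apply: eq_integral => x _; rewrite EFin_density.
Qed.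

(** The change of variables formula is first available for nonnegative
    functions; as p >= 0, multiplication by p commutes with taking positive and
    negative parts, which extends it to signed functions. *)
Lemma integral_density (k : T -> R) : measurable_fun [set: T] k ->
  nu.-integrable [set: T] (fun x => (k x * p x)%:E) ->
  mu.-integrable [set: T] (EFin \o k) /\
  \int[mu]_x (k x)%:E = \int[nu]_x (k x * p x)%:E.
Proof.
move=> mk /integrableP[mkp kp].
have mk' : measurable_fun [set: T] (EFin \o k) by exact/measurable_EFinP.
split.
  apply/integrableP; split => //.
  rewrite -ge0_integral_density//; last exact: measurableT_comp.
  apply: le_lt_trans kp; rewrite le_eqVlt; apply/orP; left; apply/eqP.
  apply: eq_integral => x _ /=.
  by rewrite -EFinM normrM (ger0_norm (density_ge0 x)).
rewrite integralE [RHS]integralE.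
rewrite -ge0_integral_density//; last exact: measurable_funepos.
rewrite -(@ge0_integral_density ((EFin \o k)^\-))//; last exact: measurable_funeneg.
congr (_ - _); apply: eq_integral => x _ /=; rewrite ?funeposE ?funenegE.
  by rewrite maxe_pMl ?lee_fin ?density_ge0// mul0e EFinM.
by rewrite maxe_pMl ?lee_fin ?density_ge0// mul0e EFinM mulNe.
Qed.

Lemma density_eq1 : {ae nu, forall x, p x = 1%R} <->
  forall A, measurable A -> mu A = nu A.
Proof.
have f_integral := Radon_Nikodym_SigmaFinite.f_integral mu_nu.
split=> [p1 A mA|munu].
  rewrite f_integral//.
  rewrite (ae_eq_integral (cst 1)) ?integral_cst ?mul1e//.
  - apply: (measurable_funS measurableT) => //.
    exact: measurable_int (Radon_Nikodym_SigmaFinite.f_integrable mu_nu).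
  - by apply: filterS p1 => x px _; rewrite -EFin_density px.
have : ae_eq nu [set: T] (EFin \o p) (cst 1).
  apply: integral_ae_eq => //; first exact: integrable_density.
  move=> E _ mE; rewrite integral_cst//= mul1e -munu// f_integral//.
  by apply: eq_integral => x _; exact: EFin_density.
by apply: filterS => x /(_ Logic.I) /= [].
Qed.

End change_of_measure.

(** * The conjugate of a normalized strictly convex function *)

Section generator.
Context (R : realType) (phi : R -> R).
Hypothesis phi_convex : strictly_convex_nonneg phi.
Hypothesis phi1 : phi 1 = 0.
Hypothesis phi_der : derivable phi 1 1.
Hypothesis dphi1 : phi^`() 1 = 0.

(** The first-order expansion of phi at 1, in the epsilon form used both for
    the sign of phi and for the strict inequality psi xi > xi. *)
Lemma generator_little_o (e : R) : 0 < e ->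
  exists2 r : R, 0 < r & forall h, `|h| < r -> `|phi (1 + h)| <= e * `|h|.
Proof.
move=> e0.
have : is_derive (1 : R) 1 phi 0.
  by rewrite -dphi1 derive1E; exact: derivableP.
case/is_derive1_caratheodory => g [phiE /cvgrPdist_le /(_ e e0) [r /= r0 Hr] g1].
exists r => // h hr.
have := phiE (1 + h); rewrite phi1 subr0 addrAC subrr add0r => ->.
rewrite normrM ler_wpM2r//.
have /= := Hr (1 + h); rewrite g1 sub0r normrN; apply.
by rewrite opprD addrA subrr sub0r normrN.
Qed.

(** If phi u < 0, the chord from 1 to u would force phi to decrease linearly
    near 1, against the zero slope there. *)
Lemma generator_ge0 (u : R) : 0 <= u -> 0 <= phi u.
Proof.
move=> u0; rewrite leNgt; apply/negP => phiu.
have u1 : u != 1 by apply: contraTN phiu => /eqP ->; rewrite phi1 ltxx.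
have d0 : 0 < `|u - 1| by rewrite normr_gt0 subr_eq0.
have e0 : 0 < - phi u / `|u - 1| by rewrite divr_gt0// oppr_gt0.
have [r r0 Hr] := generator_little_o e0.
pose t := Num.min (1 / 2) (r / (2 * `|u - 1|)).
have t0 : 0 < t by rewrite lt_min; apply/andP; split; rewrite divr_gt0// mulr_gt0.
have t1 : t < 1 by rewrite gt_min; apply/orP; left; lra.
have tr : `|t * (u - 1)| < r.
  rewrite normrM (gtr0_norm t0) -ltr_pdivlMr// gt_min; apply/orP; right.
  by rewrite invfM mulrA ltr_pM2r ?invr_gt0//; lra.
have := phi_convex u0 ler01 u1 t0 t1.
rewrite phi1 mulr0 addr0 mulr1 (_ : t * u + (1 - t) = 1 + t * (u - 1)); last lra.
move=> H; have /ler_normlP[+ _] := Hr _ tr.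
rewrite normrM (gtr0_norm t0) mulrCA divfK ?gt_eqF// => H2.
lra.
Qed.

(** A second zero u would make phi negative at the midpoint of 1 and u. *)
Lemma generator_gt0 (u : R) : 0 <= u -> u != 1 -> 0 < phi u.
Proof.
move=> u0 u1.
have h : 0 < 2^-1 :> R by rewrite invr_gt0.
have h1 : 2^-1 < 1 :> R by lra.
have H := phi_convex u0 ler01 u1 h h1.
have := @generator_ge0 (2^-1 * u + (1 - 2^-1) * 1) _.
move: H; rewrite phi1 => H H2.
have /H2 : 0 <= 2^-1 * u + (1 - 2^-1) * 1 by lra.
by lra.
Qed.

(** Convexity along the segment from 1 to u, with the end points t = 0, t = 1
    and the degenerate case u = 1 included. *)
Lemma generator_chord (v u t : R) : 0 <= u -> 0 <= t <= 1 ->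
  v = t * u + (1 - t) -> phi v <= t * phi u.
Proof.
move=> u0 /andP[t0 t1] ->.
have [->|u1] := eqVneq u 1; first by rewrite mulr1 addrC subrK phi1 mulr0.
have [->|tn0] := eqVneq t 0; first by rewrite !mul0r add0r subr0 phi1.
have [->|tn1] := eqVneq t 1; first by rewrite !mul1r subrr addr0.
have := phi_convex u0 ler01 u1 (_ : 0 < t) (_ : t < 1).
rewrite mulr1 phi1 mulr0 addr0 => H; apply/ltW/H.
  by rewrite lt_neqAle eq_sym tn0.
by rewrite lt_neqAle tn1.
Qed.

Local Notation psi := (convex_conjugate phi).

(** This is Young's inequality u xi <= phi u + psi xi; all the duality estimates
    below are instances of it. *)
Lemma conjugate_ge (u xi : R) : 0 <= u -> ((u * xi - phi u)%:E <= psi xi)%E.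
Proof. by move=> u0; apply: ereal_sup_ubound; exists u. Qed.

Lemma conjugate_le (xi : R) (a : \bar R) :
  (forall u, 0 <= u -> ((u * xi - phi u)%:E <= a)%E) -> (psi xi <= a)%E.
Proof. by move=> H; apply: ge_ereal_sup => _ [u /= u0 <-]; exact: H. Qed.

Lemma conjugate_ge_id xi : (xi%:E <= psi xi)%E.
Proof. by have := conjugate_ge xi ler01; rewrite mul1r phi1 subr0. Qed.

Lemma conjugate_ge_cst xi : ((- phi 0)%:E <= psi xi)%E.
Proof. by have := conjugate_ge xi (lexx 0); rewrite mul0r sub0r. Qed.

Lemma conjugate0 : psi 0 = 0%E.
Proof.
apply/eqP; rewrite eq_le conjugate_ge_id andbT; apply: conjugate_le => u u0.
by rewrite mulr0 sub0r lee_fin oppr_le0 generator_ge0.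
Qed.

Lemma conjugate_nondecreasing (x y : R) : x <= y -> (psi x <= psi y)%E.
Proof.
move=> xy; apply: conjugate_le => u u0.
apply: le_trans (conjugate_ge y u0).
by rewrite lee_fin lerB// ler_wpM2l.
Qed.

(** This is convexity of psi together with psi 0 = 0: the slope
    psi (t xi) / t is nondecreasing in t. It follows directly from phi >= 0,
    since t u xi - phi u <= t (u xi - phi u). *)
Lemma conjugate_scale_le (t xi : R) : 0 < t -> t <= 1 ->
  (psi (t * xi) <= t%:E * psi xi)%E.
Proof.
move=> t0 t1; apply: conjugate_le => u u0.
apply: (@le_trans _ _ (t%:E * (u * xi - phi u)%:E)%E).
  rewrite -EFinM lee_fin mulrBr mulrCA lerB//.
  by rewrite ler_piMl// generator_ge0.
by rewrite lee_pmul2l ?lte_fin//; exact: conjugate_ge.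
Qed.

(** The upper half of psi'(0) = 1. For |xi| small, the slope xi is dominated by
    the slope of the chord of phi from 1 to 1 + t or from 1 to 1 - t, so values
    u farther than t from 1 contribute at most xi to the supremum, and closer
    values at most xi + t |xi|. *)
Lemma conjugate_le_near0 (e : R) : 0 < e -> exists2 r, 0 < r &
  forall xi, `|xi| <= r -> (psi xi <= (xi + e * `|xi|)%:E)%E.
Proof.
suff H (t : R) : 0 < t -> t < 1 -> exists2 r, 0 < r &
    forall xi, `|xi| <= r -> (psi xi <= (xi + t * `|xi|)%:E)%E.
  move=> e0; have m0 : 0 < Num.min e 2^-1 by rewrite lt_min e0 invr_gt0 ltr0n.
  have m1 : Num.min e 2^-1 < 1 by rewrite gt_min; apply/orP; right; lra.
  have [r r0 Hr] := H _ m0 m1.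
  exists r => // xi /Hr /le_trans; apply; rewrite lee_fin lerD2l ler_wpM2r//.
  by rewrite ge_min lexx.
move=> t0 t1.
have pp : 0 < phi (1 + t) by apply: generator_gt0; lra.
have pm : 0 < phi (1 - t) by apply: generator_gt0; lra.
exists (Num.min (phi (1 + t) / t) (phi (1 - t) / t)).
  by rewrite lt_min !divr_gt0.
move=> xi; rewrite le_min => /andP[].
rewrite !ler_pdivlMr// => xip xim.
apply: conjugate_le => u u0; rewrite lee_fin.
have pu := generator_ge0 u0.
have [x0|x0] := leP 0 xi.
  rewrite ger0_norm// in xip xim *.
  have [ud|ud] := leP u (1 + t); first by nra.
  have := @generator_chord (1 + t) u (t / (u - 1)) u0.
  have u10 : 0 < u - 1 by lra.
  have -> : 0 <= t / (u - 1) <= 1.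
    by rewrite ler_pdivrMr// mul1r divr_ge0 /=; lra.
  have -> : t / (u - 1) * u + (1 - t / (u - 1)) = 1 + t.
    by rewrite addrCA -[X in _ + (_ - X)]mulr1 -mulrBr divfK// gt_eqF.
  move=> /(_ isT erefl); rewrite mulrAC ler_pdivlMr// => H.
  nra.
rewrite ltr0_norm// in xip xim *.
have [ud|ud] := leP (1 - t) u; first by nra.
have := @generator_chord (1 - t) u (t / (1 - u)) u0.
have u10 : 0 < 1 - u by lra.
have -> : 0 <= t / (1 - u) <= 1.
  by rewrite ler_pdivrMr// mul1r divr_ge0 /=; lra.
have -> : t / (1 - u) * u + (1 - t / (1 - u)) = 1 - t.
  rewrite addrCA -[X in _ + (_ - X)]mulr1 -mulrBr -(opprB 1 u) mulrN divfK//.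
  by rewrite gt_eqF.
move=> /(_ isT erefl); rewrite mulrAC ler_pdivlMr// => H.
nra.
Qed.

(** Moving u from 1 to 1 + h in the direction of xi gains |h| |xi| in the
    linear term and loses only o(h) in phi (1 + h). *)
Lemma conjugate_gt_id xi : xi != 0 -> (xi%:E < psi xi)%E.
Proof.
move=> xi0.
have e0 : 0 < `|xi| / 2 by rewrite divr_gt0 ?normr_gt0.
have [r r0 Hr] := generator_little_o e0.
pose h := Num.sg xi * Num.min (r / 2) 1.
have m0 : 0 < Num.min (r / 2) 1 by rewrite lt_min ltr01 andbT divr_gt0.
have nh : `|h| = Num.min (r / 2) 1 by rewrite normrM normr_sg xi0 mul1r gtr0_norm.
have hr : `|h| < r by rewrite nh gt_min; apply/orP; left; lra.
have h1 : `|h| <= 1 by rewrite nh ge_min lexx orbT.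
have u0 : 0 <= 1 + h by move/ler_normlP : h1 => [? _]; lra.
apply: lt_le_trans (conjugate_ge xi u0); rewrite lte_fin.
have hx : h * xi = `|h| * `|xi| by rewrite nh /h mulrAC -normrEsg mulrC.
have := Hr h hr => /ler_normlP[_ H].
rewrite mulrDl mul1r hx.
have : 0 < `|h| * `|xi| by rewrite mulr_gt0 ?nh ?normr_gt0.
lra.
Qed.

(** As a supremum of affine functions, psi is lower semicontinuous. *)
Lemma measurable_conjugate : measurable_fun [set: R] psi.
Proof.
apply: lower_semicontinuous_measurable => x a /ereal_sup_gt[_ [u /= u0 <-]].
rewrite lte_fin => aux.
have H : u * y - phi u @[y --> x] --> u * x - phi u.
  by apply: cvgB; [apply: cvgM; [exact: cvg_cst|exact: cvg_id]|exact: cvg_cst].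
exists [set y | a < u * y - phi u] => [|y /= ay]; first exact: (cvgr_gt _ H).
by apply: lt_le_trans (conjugate_ge y u0); rewrite lte_fin.
Qed.

(** * Integrability in the Orlicz space *)

Section orlicz_space.
Context d (T : measurableType d) (nu : probability T R).
Local Open Scope ereal_scope.

Lemma measurable_conjugate_scale (g : T -> R) (l : R) :
  measurable_fun [set: T] g ->
  measurable_fun [set: T] (fun x => psi (l * g x)%R).
Proof.
move=> mg; apply: (measurableT_comp measurable_conjugate).
exact: measurable_funM.
Qed.

Lemma orlicz_conjugate_integrable (f : T -> R) (gamma : R) : orlicz phi nu f ->
  gamma != 0%R -> nu.-integrable [set: T] (fun x => psi (gamma * f x)%R).
Proof.
move=> [mf H].
suff K r : (0 < r)%R -> nu.-integrable [set: T] (fun x => psi (r * f x)%R) /\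
    nu.-integrable [set: T] (fun x => psi (- r * f x)%R).
  case: (ltgtP gamma 0%R) => // gamma0 _; last by case: (K _ gamma0).
  by have [_] := K (- gamma)%R (ltac:(by rewrite oppr_gt0)); rewrite opprK.
move=> r0.
have [L1 I1] := integral_lbounded nu (measurable_conjugate_scale r mf)
  (fun x => conjugate_ge_cst _).
have [L2 I2] := integral_lbounded nu (measurable_conjugate_scale (- r) mf)
  (fun x => conjugate_ge_cst _).
split; [apply: I1|apply: I2].
  move: L1 L2 (H _ r0); case: (\int[nu]_x psi (r * f x)%R) => //.
  by case: (\int[nu]_x psi (- r * f x)%R).
move: L1 L2 (H _ r0); case: (\int[nu]_x psi (- r * f x)%R) => //.
by case: (\int[nu]_x psi (r * f x)%R).
Qed.

(** Integrability of f is read off from |f| <= |psi f| + |psi (- f)|. *)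
Lemma orlicz_integrable (f : T -> R) : orlicz phi nu f ->
  nu.-integrable [set: T] (EFin \o f).
Proof.
move=> Lf; have [mf _] := Lf.
have n1 : (1 : R)%R != 0%R by [].
have nN1 : (- 1 : R)%R != 0%R by rewrite oppr_eq0.
have /integrable_abse I1 := orlicz_conjugate_integrable Lf n1.
have /integrable_abse I2 := orlicz_conjugate_integrable Lf nN1.
apply: le_integrable (integrableD _ I1 I2) => //; first exact/measurable_EFinP.
move=> x _ /=; rewrite mul1r mulN1r.
rewrite [leRHS]gee0_abs ?adde_ge0//.
have [f0|f0] := leP 0%R (f x).
  rewrite ger0_norm//; apply: (le_trans (conjugate_ge_id _)).
  by apply: (le_trans (lee_abs _)); rewrite leeDl.
rewrite ltr0_norm//; apply: (le_trans (conjugate_ge_id _)).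
by apply: (le_trans (lee_abs _)); rewrite leeDr.
Qed.

(** If psi xi is infinite, integrability of psi (n f) and psi (- n f) forces
    n |f| < xi almost everywhere, for every n. *)
Lemma orlicz_trivial (f : T -> R) (xi : R) : orlicz phi nu f ->
  psi xi = +oo -> {ae nu, forall x, f x = 0%R}.
Proof.
move=> Lf psioo.
have xi0 : (0 < xi)%R.
  rewrite ltNge; apply/negP => /conjugate_nondecreasing.
  by rewrite psioo conjugate0.
have I (n : nat) : {ae nu, forall x, psi (n.+1%:R * f x)%R < +oo /\
    psi (- n.+1%:R * f x)%R < +oo}.
  have p : (n.+1%:R : R)%R != 0%R by rewrite pnatr_eq0.
  have q : (- n.+1%:R : R)%R != 0%R by rewrite oppr_eq0 pnatr_eq0.
  have := integrable_ae measurableT (orlicz_conjugate_integrable Lf p).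
  have := integrable_ae measurableT (orlicz_conjugate_integrable Lf q).
  apply: filterS2 => x /(_ Logic.I) h1 /(_ Logic.I) h2.
  by rewrite !ltey_eq h1 h2.
have B (y : R) (n : nat) : psi (n.+1%:R * y)%R < +oo -> (n.+1%:R * y < xi)%R.
  move=> h; rewrite ltNge; apply/negP => /conjugate_nondecreasing.
  by rewrite psioo leye_eq => /eqP e; rewrite e in h.
have := ae_foralln I; apply: filterS => x H.
apply/eqP; rewrite -normr_eq0; apply/negPn/negP => fx0.
have f0 : (0 < `|f x|)%R by rewrite lt_neqAle eq_sym fx0 /=.
have [h1 h2] := H (Num.truncn (xi / `|f x|)).
have := B _ _ h1; rewrite mulNr -mulrN in h2; have := B _ _ h2.
have := truncnS_gt (xi / `|f x|)%R.
rewrite ltr_pdivrMr// => h.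
have [p|p] := leP 0%R (f x).
  by move=> _ h3; move: h; rewrite ger0_norm// in h3 *; rewrite ltNge (ltW h3).
by move=> h3 _; move: h; rewrite ltr0_norm// in h3 *; rewrite ltNge (ltW h3).
Qed.

(** Constants need not belong to the Orlicz space, since psi may take the value
    +oo; but then f, and with it its mean, vanishes. Otherwise
    l (f - c) is at most the larger of 2 l f and - 2 l c, and psi is
    nondecreasing and bounded below. *)
Lemma conjugate_centered_integrable (f : T -> R) (l : R) : orlicz phi nu f ->
  nu.-integrable [set: T] (fun x => psi (l * (f x - fine 'E_nu[f]))%R).
Proof.
move=> Lf; have [mf _] := Lf.
have [->|l0] := eqVneq l 0%R.
  under eq_fun do rewrite mul0r conjugate0.
  exact: integrable0.
have [finpsi|/existsNP[xi /negP]] := pselect (forall xi, psi xi < +oo); last first.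
  rewrite -leNgt leye_eq => /eqP psioo.
  suff -> : 'E_nu[f] = 0.
    by under eq_fun do rewrite subr0; exact: orlicz_conjugate_integrable.
  rewrite unlock (ae_eq_integral (cst 0)) ?integral0//.
    exact/measurable_EFinP.
  by apply: filterS (orlicz_trivial Lf psioo) => x -> _.
set c := fine _.
have l2 : (2 * l)%R != 0%R by rewrite mulf_neq0.
have /integrable_abse I1 := orlicz_conjugate_integrable Lf l2.
have Ic : psi (- (2 * l * c))%R \is a fin_num.
  rewrite fin_numElt finpsi andbT.
  exact: (lt_le_trans (ltNyr _) (conjugate_ge_id _)).
(* psi (- 2 l c) bounds psi (l (f - c)) from above where l f <= - l c, and
   - phi 0 bounds it from below *)
pose K := (`|fine (psi (- (2 * l * c)))| + `|phi 0|)%R.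
have IK := finite_measure_integrable_cst nu K measurableT.
apply: le_integrable (integrableD _ I1 IK) => //.
  apply: measurable_conjugate_scale; exact: measurable_funB.
move=> x _ /=.
have K0 : (0 <= K)%R by rewrite addr_ge0.
rewrite [leRHS]gee0_abs ?adde_ge0//.
have H1 : - psi (l * (f x - c))%R <= K%:E.
  rewrite leeNl -EFinN; apply: le_trans (conjugate_ge_cst _).
  by rewrite lee_fin lerN2 (le_trans (ler_norm _))// lerDr.
have H2 : psi (l * (f x - c))%R <= `|psi (2 * l * f x)%R| + K%:E.
  have [h|h] := leP (l * f x)%R (- (l * c))%R.
    apply: (@le_trans _ _ (psi (- (2 * l * c))%R)).
      by apply: conjugate_nondecreasing; lra.
    rewrite -(fineK Ic) (@le_trans _ _ K%:E) ?leeDr//.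
    by rewrite lee_fin (le_trans (ler_norm _))// lerDl.
  apply: (@le_trans _ _ (psi (2 * l * f x)%R)).
    by apply: conjugate_nondecreasing; lra.
  by rewrite (le_trans (lee_abs _))// leeDl// lee_fin.
have [h|h] := leP 0 (psi (l * (f x - c))%R); first by rewrite gee0_abs.
by rewrite lte0_abs// (le_trans H1)// leeDr.
Qed.

End orlicz_space.

(** * The dual bound for a centered function *)

Section finite_divergence.
Context d (T : measurableType d) (mu nu : probability T R).
Hypothesis mu_nu : mu `<< nu.
Let p x := fine (Radon_Nikodym_SigmaFinite.f mu nu x).
Hypothesis phi_p : nu.-integrable [set: T] (fun x => (phi (p x))%:E).
Local Open Scope ereal_scope.

Let D := \int[nu]_x (phi (p x))%:E.

Let p_ge0 x : (0 <= p x)%R. Proof. exact: density_ge0. Qed.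

Lemma divergence_integral_ge0 : 0 <= D.
Proof. by apply: integral_ge0 => x _; rewrite lee_fin generator_ge0. Qed.

Lemma divergence_integral_eq0 :
  D = 0 <-> forall A, measurable A -> mu A = nu A.
Proof.
rewrite -(density_eq1 mu_nu); split=> [D0|p1].
  have : \int[nu]_x `|(phi (p x))%:E| = 0.
    rewrite -D0; apply: eq_integral => x _.
    by rewrite gee0_abs// lee_fin generator_ge0.
  move/(ae_eq_integral_abs nu measurableT (measurable_int _ phi_p)).
  apply: filterS => x /(_ Logic.I) /= [phi0].
  apply/eqP/negPn/negP => /(generator_gt0 (p_ge0 x)).
  by rewrite phi0 ltxx.
rewrite /D (ae_eq_integral (cst 0)) ?integral0//; first exact: measurable_int phi_p.
by apply: filterS p1 => x px _; rewrite /= /p px phi1.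
Qed.

Definition conjugate_bound (g : T -> R) : \bar R :=
  ereal_inf [set (l^-1)%R%:E * (\int[nu]_x psi (l * g x)%R) + (l^-1)%R%:E * D
            | l in [set l : R | (0 < l)%R]].

Section centered.
Variable g : T -> R.
Hypothesis Ig : nu.-integrable [set: T] (EFin \o g).
Hypothesis mean0 : \int[nu]_x (g x)%:E = 0.
Hypothesis Ipsi : forall l, nu.-integrable [set: T] (fun x => psi (l * g x)%R).

Let mg : measurable_fun [set: T] g.
Proof. by apply/measurable_EFinP; exact: measurable_int Ig. Qed.

Lemma young_density (l : R) x :
  (l * g x * p x)%:E <= psi (l * g x)%R + (phi (p x))%:E.
Proof.
have := conjugate_ge (l * g x) (p_ge0 x).
by rewrite EFinB leeBlDr// (mulrC (p x)).
Qed.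

(** Young's inequality at slopes 1 and - 1 bounds |g| p; this is what makes g
    integrable under mu. *)
Lemma integrable_mul_density :
  nu.-integrable [set: T] (fun x => (g x * p x)%:E).
Proof.
have /integrable_abse I1 := Ipsi 1.
have /integrable_abse I2 := Ipsi (- 1).
have /integrable_abse I3 := phi_p.
apply: le_integrable (integrableD _ (integrableD _ I1 I2) I3) => //.
  by apply/measurable_EFinP/measurable_funM => //; exact: measurable_density.
move=> x _ /=.
rewrite [leRHS]gee0_abs ?adde_ge0// normrM (ger0_norm (p_ge0 x)).
have [g0|g0] := leP 0%R (g x).
  have := young_density 1 x; rewrite mul1r ger0_norm// => /le_trans; apply.
  apply: leeD; last exact: lee_abs.
  by apply: (le_trans (lee_abs _)); rewrite leeDl.
have := young_density (- 1) x; rewrite mulN1r ltr0_norm// => /le_trans; apply.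
apply: leeD; last exact: lee_abs.
by apply: (le_trans (lee_abs _)); rewrite leeDr.
Qed.

Lemma integrable_mu : mu.-integrable [set: T] (EFin \o g).
Proof. by have [] := integral_density mu_nu mg integrable_mul_density. Qed.

Lemma gibbs_variational (l : R) :
  l%:E * \int[mu]_x (g x)%:E <= \int[nu]_x psi (l * g x)%R + D.
Proof.
have [_ ->] := integral_density mu_nu mg integrable_mul_density.
rewrite -integralZl//; last exact: integrable_mul_density.
rewrite -integralD//; apply: le_integral => //.
- by apply: integrableZl => //; exact: integrable_mul_density.
- exact: integrableD.
- by move=> x _; rewrite -EFinM mulrA; exact: young_density.
Qed.

(** Jensen's inequality, in the form psi (l g) >= l g with g centered. *)
Lemma integral_conjugate_ge0 (l : R) : 0 <= \int[nu]_x psi (l * g x)%R.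
Proof.
rewrite -(mule0 l%:E) -mean0 -integralZl//; apply: le_integral => //.
  exact: integrableZl.
by move=> x _; exact: conjugate_ge_id.
Qed.

Lemma conjugate_bound_ge_mean : \int[mu]_x (g x)%:E <= conjugate_bound g.
Proof.
apply: le_ereal_inf_tmp => _ [l /= l0 <-].
rewrite -ge0_muleDr ?integral_conjugate_ge0 ?divergence_integral_ge0//.
by rewrite muleC lee_pdivlMr// muleC gibbs_variational.
Qed.

Lemma conjugate_bound_ge0 : 0 <= conjugate_bound g.
Proof.
apply: le_ereal_inf_tmp => _ [l /= l0 <-].
have il0 : 0 <= (l^-1)%:E by rewrite lee_fin invr_ge0 ltW.
by rewrite adde_ge0// mule_ge0// ?integral_conjugate_ge0 ?divergence_integral_ge0.
Qed.

Lemma conjugate_bound_le (l : R) : (0 < l)%R -> conjugate_bound g <=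
  (l^-1)%:E * (\int[nu]_x psi (l * g x)%R) + (l^-1)%:E * D.
Proof. by move=> l0; apply: ereal_inf_lbound; exists l. Qed.

Lemma conjugate_bound_fin_num : conjugate_bound g \is a fin_num.
Proof.
rewrite ge0_fin_numE ?conjugate_bound_ge0//.
apply: (le_lt_trans (conjugate_bound_le ltr01)).
by rewrite invr1 !mul1e lte_add_pinfty// integrable_lty.
Qed.

(** The two terms cannot be small together: the divergence term is at least D
    for l < 1, the conjugate term stays away from 0 for l >= 1. *)
Lemma conjugate_bound_gt0 : 0 < D -> ~ {ae nu, forall x, g x = 0%R} ->
  0 < conjugate_bound g.
Proof.
move=> D0 gn0.
have P0 : 0 < \int[nu]_x psi (1 * g x)%R.
  rewrite lt_neqAle integral_conjugate_ge0 andbT; apply/negP => /eqP P0.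
  apply: gn0.
  have : \int[nu]_x `|psi (1 * g x)%R - (g x)%:E| = 0.
    under eq_integral do rewrite gee0_abs ?sube_ge0 ?mul1r ?conjugate_ge_id//.
    under eq_integral do rewrite -[X in psi X]mul1r.
    by rewrite integralB// -P0 mean0 sube0.
  have mpsi : measurable_fun [set: T] (fun x => psi (1 * g x)%R - (g x)%:E).
    by have := measurable_int _ (integrableB measurableT (Ipsi 1) Ig).
  move/(ae_eq_integral_abs nu measurableT mpsi).
  apply: filterS => x /(_ Logic.I) /=; rewrite mul1r => e.
  apply/eqP/negPn/negP => /conjugate_gt_id.
  by rewrite -sube_gt0 e ltxx.
apply: (@lt_le_trans _ _ (mine (\int[nu]_x psi (1 * g x)%R) D)).
  by rewrite lt_min P0.
apply: le_ereal_inf_tmp => _ [l /= l0 <-].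
have il0 : 0 <= (l^-1)%:E by rewrite lee_fin invr_ge0 ltW.
have [l1|l1] := leP 1%R l; rewrite ge_min; apply/orP; [left|right].
  apply: (@le_trans _ _ ((l^-1)%:E * (\int[nu]_x psi (l * g x)%R))).
    rewrite -integralZl//; apply: le_integral => //; first exact: integrableZl.
    move=> x _; rewrite (_ : 1 * g x = l^-1 * (l * g x))%R.
      by rewrite conjugate_scale_le// ?invr_gt0// invf_le1.
    by rewrite mulrA mulVf// gt_eqF.
  by rewrite leeDl// mule_ge0// ltW.
apply: (@le_trans _ _ ((l^-1)%:E * D)).
  rewrite -[leLHS]mul1e lee_pmul// ?(ltW D0)// lee_fin.
  by rewrite invf_ge1// ltW.
by rewrite leeDr// mule_ge0// integral_conjugate_ge0.
Qed.

(** Only l^-1 D is left, and l can be taken arbitrarily large. *)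
Lemma conjugate_bound_ae0 : {ae nu, forall x, g x = 0%R} ->
  conjugate_bound g <= 0.
Proof.
move=> g0; apply/lee_addgt0Pr => e e0; rewrite add0e.
have Dfin : D \is a fin_num by exact: integrable_fin_num.
have D0 : (0 <= fine D)%R by rewrite fine_ge0// divergence_integral_ge0.
(* D / l <= e, the + 1 keeping l positive when D = 0 *)
pose l := ((fine D + 1) / e)%R.
have l0 : (0 < l)%R by rewrite divr_gt0// ltr_wpDl.
apply: (le_trans (conjugate_bound_le l0)).
have -> : \int[nu]_x psi (l * g x)%R = 0.
  rewrite (ae_eq_integral (cst 0)) ?integral0//; first exact: measurable_int (Ipsi l).
  by apply: filterS g0 => x -> _; rewrite mulr0 conjugate0.
rewrite mule0 add0e -(fineK Dfin) -EFinM lee_fin /l invf_div.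
rewrite -mulrA ler_piMr// ?(ltW e0)// mulrC ler_pdivrMr ?ltr_wpDl//.
by rewrite mul1r lerDl.
Qed.

(** As l = 1 / (n + 1) tends to 0, psi (l g) / l converges to g and stays between
    g and psi g, so dominated convergence sends the bound to the mean of g. *)
Lemma conjugate_bound_div0 : D = 0 -> conjugate_bound g <= 0.
Proof.
move=> D0.
pose F n x := n.+1%:R%:E * psi (n.+1%:R^-1 * g x)%R.
have n0 n : (0 < n.+1%:R :> R)%R by rewrite ltr0n.
have in0 n : (0 < n.+1%:R^-1 :> R)%R by rewrite invr_gt0.
have Flb n x : (g x)%:E <= F n x.
  rewrite /F muleC -lee_pdivrMr// muleC -EFinM; exact: conjugate_ge_id.
have Fub n x : F n x <= psi (g x).
  rewrite /F muleC -lee_pdivlMr// muleC.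
  by apply: conjugate_scale_le; rewrite ?invf_le1// ler1n.
have Iabs : nu.-integrable [set: T] (fun x => `|psi (1 * g x)%R| + `|(g x)%:E|).
  by apply: integrableD => //; exact: integrable_abse.
have mF n : measurable_fun [set: T] (F n).
  exact: measurable_int (integrableZl measurableT _ (Ipsi _)).
have Fdom : {ae nu, forall x n, setT x ->
    `|F n x| <= `|psi (1 * g x)%R| + `|(g x)%:E|}.
  apply: aeW => x n _; rewrite mul1r.
  have [h|h] := leP 0 (F n x).
    rewrite gee0_abs// (le_trans (Fub _ _))// (le_trans (lee_abs _))//.
    by rewrite leeDl.
  rewrite lte0_abs//; apply: (@le_trans _ _ (- (g x)%:E)); first by rewrite leeN2.
  by rewrite (le_trans (lee_abs _))// abseN leeDr.
have Fcvg : {ae nu, forall x, setT x -> F ^~ x @ \oo --> (g x)%:E}.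
  apply: aeW => x _.
  have near_le (e : R) : (0 < e)%R -> \forall n \near \oo,
      F n x <= (g x + e)%:E.
    move=> e0.
    have a0 : (0 < `|g x| + 1)%R by rewrite ltr_wpDl.
    have [r r0 Hr] := conjugate_le_near0 (divr_gt0 e0 a0).
    have ra0 : (0 < r / (`|g x| + 1))%R by rewrite divr_gt0.
    near=> n.
    have nr : (n.+1%:R^-1 < r / (`|g x| + 1))%R.
      by near: n; exact: (near_infty_natSinv_lt (PosNum ra0)).
    rewrite /F muleC -lee_pdivlMr// muleC -EFinM.
    have := Hr (n.+1%:R^-1 * g x)%R; rewrite normrM gtr0_norm// => H.
    apply: le_trans (H _) _.
      rewrite ltr_pdivlMr// in nr; apply: ltW; apply: le_lt_trans nr.
      by rewrite ler_wpM2l ?ler_wpDr// ltW.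
    rewrite lee_fin mulrDr lerD2l mulrCA ler_wpM2l// ?(ltW (in0 n))//.
    by rewrite mulrAC ler_pdivrMr// ler_wpM2l ?(ltW e0)// lerDl.
  have fin n : F n x < +oo -> F n x \is a fin_num.
    by move=> h; rewrite fin_numElt h andbT (lt_le_trans _ (Flb n x))// ltNyr.
  apply/fine_cvgP; split.
    by apply: filterS (near_le _ ltr01) => n /le_lt_trans h; apply/fin/h/ltry.
  apply/cvgrPdist_le => e e0; apply: filterS (near_le _ e0) => n h.
  have hn : F n x \is a fin_num by apply: fin; exact: le_lt_trans h (ltry _).
  have := Flb n x; move: h; rewrite /= -(fineK hn) !lee_fin /= => h1 h2.
  by rewrite distrC ger0_norm ?subr_ge0// lerBlDl.
have [_ _] := dominated_convergence measurableT mF (measurable_int _ Ig) Fcvg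
  Iabs Fdom.
rewrite [X in _ --> X]mean0; apply: cvge_ge; apply: nearW => n.
apply: (le_trans (conjugate_bound_le (in0 n))).
by rewrite D0 mule0 adde0 invrK /F /= integralZl.
Unshelve. all: by end_near. Qed.

End centered.
End finite_divergence.

(** * Bounds on differences of expectations *)

Section divergence_bounds.
Context d (T : measurableType d) (mu nu : probability T R).
Local Open Scope ereal_scope.

Lemma divergence_lty : divergence phi mu nu < +oo ->
  let h x := (phi (fine (Radon_Nikodym_SigmaFinite.f mu nu x)))%:E in
  [/\ mu `<< nu, nu.-integrable [set: T] h &
      divergence phi mu nu = \int[nu]_x h x].
Proof. by rewrite /divergence; case: asboolP => // -[]. Qed.

Hypothesis div_fin : divergence phi mu nu < +oo.

Lemma bound_plusE f :
  bound_plus phi mu nu f = conjugate_bound mu nu (fun x => f x - fine 'E_nu[f])%R.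
Proof. by have [_ _ divE] := divergence_lty div_fin; rewrite /bound_plus divE. Qed.

Lemma bound_minusE f :
  bound_minus phi mu nu f =
  - conjugate_bound mu nu (fun x => - (f x - fine 'E_nu[f]))%R.
Proof.
have [_ _ divE] := divergence_lty div_fin; rewrite /bound_minus divE.
rewrite /conjugate_bound; congr (- ereal_inf _); apply: eq_imagel => l _.
by congr (_ * _ + _); apply: eq_integral => x _; rewrite mulrN mulNr.
Qed.

(** The lower bound is the upper bound for - g, which lies in the same class as
    g; positivity of the upper bound alone already yields the rigidity
    statement. *)
Theorem divergence_expectation_bounds (f : T -> R) : orlicz phi nu f ->
  exists Bminus Bplus : R,
    [/\ Bminus%:E = bound_minus phi mu nu f,
        Bplus%:E = bound_plus phi mu nu f,
        Bminus%:E <= 'E_mu[f] - 'E_nu[f],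
        'E_mu[f] - 'E_nu[f] <= Bplus%:E &
        (Bplus = 0%R /\ Bminus = 0%R) <->
        ((forall A : set T, measurable A -> mu A = nu A) \/
         (exists c : R, {ae nu, forall x, f x = c}))].
Proof.
move=> Lf; have [mu_nu phi_p _] := divergence_lty div_fin.
have If := orlicz_integrable Lf.
have [mf _] := Lf.
have Ef : 'E_nu[f] = \int[nu]_x (f x)%:E by rewrite unlock.
have Efin : 'E_nu[f] \is a fin_num by rewrite Ef integrable_fin_num.
rewrite bound_plusE bound_minusE.
pose c := fine 'E_nu[f]; pose g x := (f x - c)%R.
have Ec : \int[nu]_x (f x)%:E = c%:E by rewrite -Ef fineK.
have Ic : nu.-integrable [set: T] (EFin \o cst c).
  exact: finite_measure_integrable_cst.
have Ig : nu.-integrable [set: T] (EFin \o g).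
  by apply: eq_integrable (integrableB measurableT If Ic).
have g0 : \int[nu]_x (g x)%:E = 0.
  under eq_integral do rewrite EFinB.
  by rewrite integralB_EFin// Ec integral_cst//= probability_setT mule1 subee.
have Ipsi l : nu.-integrable [set: T] (fun x => psi (l * g x)%R).
  exact: conjugate_centered_integrable.
pose k x := (- g x)%R.
have Ik : nu.-integrable [set: T] (EFin \o k).
  by apply: eq_integrable (integrableN Ig).
have k0 : \int[nu]_x (k x)%:E = 0.
  under eq_integral do rewrite EFinN.
  by rewrite integralN ?g0 ?oppe0// integrable_add_def.
have Kpsi l : nu.-integrable [set: T] (fun x => psi (l * k x)%R).
  by apply: eq_integrable (Ipsi (- l)%R) => // x _; rewrite mulNr mulrN.
have Imu := integrable_mu mu_nu phi_p Ig Ipsi.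
have Icmu : mu.-integrable [set: T] (EFin \o cst c).
  exact: finite_measure_integrable_cst.
have Emu : 'E_mu[f] - 'E_nu[f] = \int[mu]_x (g x)%:E.
  have Ifmu : mu.-integrable [set: T] (EFin \o f).
    apply: eq_integrable (integrableD measurableT Imu Icmu) => // x _ /=.
    by rewrite -EFinD subrK.
  rewrite Ef Ec unlock; under [RHS]eq_integral do rewrite EFinB.
  by rewrite integralB_EFin// integral_cst//= probability_setT mule1.
have Eneg : \int[mu]_x (k x)%:E = - \int[mu]_x (g x)%:E.
  under eq_integral do rewrite EFinN.
  by rewrite integralN// integrable_add_def.
have /EFin_fin_numP[bp Bp] : conjugate_bound mu nu g \is a fin_num.
  exact: conjugate_bound_fin_num.
have /EFin_fin_numP[bm Bm] : conjugate_bound mu nu k \is a fin_num.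
  exact: conjugate_bound_fin_num.
have Ple : \int[mu]_x (g x)%:E <= conjugate_bound mu nu g.
  exact: conjugate_bound_ge_mean.
have Mle : \int[mu]_x (k x)%:E <= conjugate_bound mu nu k.
  exact: conjugate_bound_ge_mean.
have P0 : 0 <= conjugate_bound mu nu g by exact: conjugate_bound_ge0.
have M0 : 0 <= conjugate_bound mu nu k by exact: conjugate_bound_ge0.
exists (- bm)%R, bp.
rewrite EFinN -Bp -Bm Emu.
split; [exact: erefl|exact: erefl|rewrite leeNl -Eneg; exact: Mle|exact: Ple|].
split=> [[PE _]|triv].
  have PE' : conjugate_bound mu nu g = 0 by rewrite Bp PE.
  have := divergence_integral_ge0 mu_nu; rewrite le_eqVlt => /orP[/eqP|] D0.
    by left; apply/(divergence_integral_eq0 mu_nu phi_p).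
  right; exists c; apply: contrapT => fc.
  have : 0 < conjugate_bound mu nu g.
    apply: conjugate_bound_gt0 => //; apply: contra_not fc; apply: filterS => x.
    by move/eqP; rewrite subr_eq0 => /eqP.
  by rewrite PE' ltxx.
suff : conjugate_bound mu nu g = 0 /\ conjugate_bound mu nu k = 0.
  by rewrite Bp Bm => -[[->] [->]]; rewrite oppr0.
suff [P0' M0'] : conjugate_bound mu nu g <= 0 /\ conjugate_bound mu nu k <= 0.
  by split; apply/le_anti/andP; [exact: (conj P0' P0)|exact: (conj M0' M0)].
case: triv => [/(divergence_integral_eq0 mu_nu phi_p) D0|[a fa]].
  by split; apply: conjugate_bound_div0.
have ac : a = c.
  apply: EFin_inj; rewrite -Ec (ae_eq_integral (cst a%:E)).
  - by rewrite integral_cst//= probability_setT mule1.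
  - by [].
  - exact/measurable_EFinP.
  - by [].
  - by apply: filterS fa => x -> _.
by split; apply: conjugate_bound_ae0 => //; apply: filterS fa => x;
  rewrite /k /g ac => ->; rewrite subrr ?oppr0.
Qed.

End divergence_bounds.
End generator.

Theorem theorem3p1 (R : realType) (X : ptopologicalType)
  (polishX : polish R X)
  (mu nu : probability (borel X) R) (phi : R -> R)
  (phi_convex : strictly_convex_nonneg phi)
  (phi_C2 : C2_pos phi)
  (phi1 : phi 1 = 0)
  (dphi1 : phi^`() 1 = 0)
  (phi_inf : (-oo < ereal_inf [set (phi x)%:E | x in [set x : R | (0 < x)%R]])%E)
  (div_fin : (divergence phi mu nu < +oo)%E)
  (f : borel X -> R) (Lf : orlicz phi nu f) :
  exists Bminus Bplus : R,
    [/\ Bminus%:E = bound_minus phi mu nu f,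
        Bplus%:E = bound_plus phi mu nu f,
        (Bminus%:E <= 'E_mu[f] - 'E_nu[f])%E,
        ('E_mu[f] - 'E_nu[f] <= Bplus%:E)%E &
        (Bplus = 0 /\ Bminus = 0) <->
        ((forall A : set (borel X), measurable A -> mu A = nu A) \/
         (exists c : R, {ae nu, forall x, f x = c}))].
Proof.
have [phi_der _ _] := phi_C2 _ ltr01.
exact: divergence_expectation_bounds.
Qed.
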